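(* Let $r:\mathbb R\to(0,\infty)$ be continuous and let $0\le q\in L_1^{\rm loc}(\mathbb R)$. Suppose that $$\int_{-\infty}^0\frac{q(t)}{r(t)}dt=\infty,\qquad \int_0^\infty\frac{q(t)}{r(t)}dt=\infty,$$ and that there is $\delta>0$ such that for all $x\in\mathbb R$ $$d(t)\ge\delta\, d(x)\qquad\text{for } |t-x|\le d(x).$$ If $\lim_{x\to-\infty}q(x)=0$ or $\lim_{x\to\infty}q(x)=0$, then the problem $$-r(x)y'(x)+q(x)y(x)=f(x),\quad x\in\mathbb R,\qquad \lim_{|x|\to\infty}y(x)=0$$ is not correctly solvable in $L_p(\mathbb R)$ for any $p\in[1,\infty]$.
   Context: For $x\in\mathbb R$, $d(x)=\inf\{d>0:\int_{x-d}^{x+d}\frac{q(t)}{r(t)}dt=2\}$ (well defined since $\int_{-\infty}^0\frac{q(t)}{r(t)}dt=\infty$). For $p\in[1,\infty)$, $L_p(\mathbb R)$ is the usual Lebesgue space with norm $\|\cdot\|_p$; for $p=\infty$ the convention is $L_\infty(\mathbb R):=C(\mathbb R)$, the space of bounded continuous functions on $\mathbb R$ with the supremum norm. A solution of the problem (for given $f\in L_p(\mathbb R)$) is any function $y$ on $\mathbb R$, absolutely continuous on every compact interval, that satisfies the differential equation almost everywhere on $\mathbb R$ and satisfies $y(x)\to0$ as $|x|\to\infty$. The problem is called correctly solvable in $L_p(\mathbb R)$ if (I) for every $f\in L_p(\mathbb R)$ there exists a unique solution $y\in L_p(\mathbb R)$, and (II) there is a constant $c_p\in(0,\infty)$, independent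 of $f$, such that $\|y\|_p\le c_p\|f\|_p$ for all $f\in L_p(\mathbb R)$. *)

(* Defs.v *)
From HB Require Import structures.
From mathcomp Require Import all_boot all_order all_algebra.
From mathcomp Require Import all_classical all_reals all_analysis.
Set Implicit Arguments.
Unset Strict Implicit.
Unset Printing Implicit Defensive.
Import Order.TTheory GRing.Theory Num.Theory.
Import numFieldNormedType.Exports.
Local Open Scope classical_set_scope.
Local Open Scope ring_scope.

Notation leb R := (@lebesgue_measure R).

(* The infimum in [reals] is a junk value on an empty set; here the set is
   nonempty as soon as q / r has infinite integral on a half-line. *)
Definition dfun (R : realType) (r q : R -> R) (x : R) : R :=
  inf [set d : R | 0 < d /\
    (\int[leb R]_(t in `[(x - d)%R, (x + d)%R]) (q t / r t)%:E = 2%:E)%E].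

(* Disjointness is that of the open intervals ]u i, v i[; they may be empty. *)
Definition abs_continuous_on (R : realType) (a b : R) (y : R -> R) : Prop :=
  forall e : R, 0 < e -> exists2 h : R, 0 < h &
    forall (n : nat) (u v : 'I_n -> R),
      (forall i, [/\ a <= u i, u i <= v i & v i <= b]) ->
      (forall i j, i != j -> v i <= u j \/ v j <= u i) ->
      \sum_(i < n) (v i - u i) < h ->
      \sum_(i < n) `|y (v i) - y (u i)| < e.

(* For p = +oo this is the space of bounded continuous functions with the
   supremum norm, not the space of essentially bounded functions. *)
Definition in_Lp (R : realType) (p : \bar R) (f : R -> R) : Prop :=
  match p with
  | +oo%E => continuous f /\ bounded_fun f
  | _ => f \in Lfun (leb R) p
  end.

Definition Lp_norm (R : realType) (p : \bar R) (f : R -> R) : \bar R :=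
  match p with
  | +oo%E => ereal_sup (range (fun x : R => `|f x|%:E))
  | _ => 'N[leb R]_p[EFin \o f]
  end.

Definition is_solution (R : realType) (r q f y : R -> R) : Prop :=
  [/\ forall a b : R, a <= b -> abs_continuous_on a b y,
      {ae leb R, forall x : R,
         derivable y x 1 /\ - r x * y^`()%classic x + q x * y x = f x},
      y x @[x --> -oo] --> (0 : R) &
      y x @[x --> +oo] --> (0 : R)].

Definition correctly_solvable (R : realType) (r q : R -> R) (p : \bar R)
    : Prop :=
  (forall f, in_Lp p f -> exists! y, is_solution r q f y /\ in_Lp p y) /\
  (exists2 c : R, 0 < c &
    forall f y, in_Lp p f -> is_solution r q f y -> in_Lp p y ->
      (Lp_norm p y <= c%:E * Lp_norm p f)%E).

(* Main.v *)
Require Import Defs.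
From mathcomp Require Import all_boot all_order all_algebra.
From mathcomp Require Import all_classical all_reals all_analysis.
From mathcomp Require Import measurable_realfun ring lra.
Set Implicit Arguments.
Unset Strict Implicit.
Import Order.TTheory GRing.Theory Num.Theory.
Import numFieldNormedType.Exports.
Local Open Scope classical_set_scope.
Local Open Scope ring_scope.

(** Correct solvability contains an a priori bound ||y|| <= c ||f||, and this
    bound fails on a family of compactly supported pairs (f, y) living where q
    is small.

    Write s and rho for primitives of q / r and 1 / r.  The function e^s solves
    the homogeneous equation, so for any C^1 function z the choice y = e^s z
    gives f = - r e^s z'.  The coefficient q has disappeared from f: the datum
    is continuous however irregular q is, hence one construction serves all p,
    including the space of bounded continuous functions for p = oo.

    Fix eps > 0 and take four points p0 < p1 < p2 < p3, far enough towards the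
    end where q -> 0 that q <= eps on [p0, p3], with s increasing by exactly 2
    from each point to the next ([levels_below_eps], [three_gaps]).  Let z rise
    from 0 to 1 on [p0, p1], equal 1 on [p1, p2] and descend to 0 on [p2, p3],
    as a function of rho.  Since q <= eps, a gap of s-length 2 has rho-length at
    least 2 / eps ([rho_gap_ge]), so that r z' = O(eps).  The factor e^s varies
    by at most e^6 over the three gaps.  Consequently |f| <= C eps on [p0, p3],
    while y >= 1 on [p1, p2] after normalising e^s at p0.

    In the sup norm this already contradicts the bound.  For finite p the
    supports matter too: one needs p3 - p0 <= K (p2 - p1) with K independent of
    eps ([Lp_norm_le]).  This is where the function d enters.  If the points are
    chosen as the least ones at their level, then half of the gap between two
    consecutive points is at most d at its midpoint ([dfun_midpoint]), whereas d
    at a common endpoint of two gaps is at most the length of either.  The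
    inequality d(t) >= delta d(x) thus makes adjacent gaps comparable
    ([consecutive_gaps_comparable]), with K = 1 + 4 / delta. *)

(** * Primitives of locally summable functions *)

Section primitive.
Context {R : realType}.
Local Notation mu := (@lebesgue_measure R).
Implicit Types (g : R -> R) (a b c x : R).

Definition locally_summable g :=
  forall a b, mu.-integrable `[a, b] (EFin \o g).

(** The signed integral from 0 to x: the second integral is over a negligible
    set when x >= 0, the first one when x <= 0. *)
Definition primitive g x : R :=
  \int[mu]_(t in `[0, x]) g t - \int[mu]_(t in `[x, 0]) g t.

Lemma Rintegral_itv_chasles g a b c : locally_summable g ->
  a <= b -> b <= c ->
  \int[mu]_(t in `[a, c]) g t =
  \int[mu]_(t in `[a, b]) g t + \int[mu]_(t in `[b, c]) g t.
Proof.
move=> ig ab bc; apply/eqP; rewrite addrC -subr_eq.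
rewrite Rintegral_itvB ?bnd_simp//; try exact: ig.
rewrite Rintegral_itv_obnd_cbnd//.
by apply: integrableS (ig b c) => //; exact: subset_itv_oc_cc.
Qed.

Lemma Rintegral_itv_le g a b : b <= a -> \int[mu]_(t in `[a, b]) g t = 0.
Proof.
rewrite le_eqVlt => /predU1P[->|ba].
  by rewrite set_itv1 Rintegral_set1.
by rewrite set_itv_ge ?Rintegral_set0// bnd_simp -ltNge.
Qed.

Lemma primitiveB g a b : locally_summable g -> a <= b ->
  primitive g b - primitive g a = \int[mu]_(t in `[a, b]) g t.
Proof.
move=> ig ab; rewrite /primitive.
have [a0|a0] := leP 0 a.
  rewrite (@Rintegral_itv_le g b 0) ?(le_trans a0)// (@Rintegral_itv_le g a 0)//.
  by rewrite (Rintegral_itv_chasles ig a0 ab)//; lra.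
have [b0|b0] := leP 0 b.
  rewrite (@Rintegral_itv_le g b 0)// (@Rintegral_itv_le g 0 a) ?ltW//.
  by rewrite (Rintegral_itv_chasles ig (ltW a0) b0)//; lra.
rewrite (@Rintegral_itv_le g 0 b) ?(ltW b0)// (@Rintegral_itv_le g 0 a) ?(ltW a0)//.
by rewrite (Rintegral_itv_chasles ig ab (ltW b0))//; lra.
Qed.

Lemma integral_primitiveB g a b : locally_summable g -> a <= b ->
  (\int[mu]_(t in `[a, b]) (g t)%:E = (primitive g b - primitive g a)%:E)%E.
Proof.
move=> ig ab; rewrite primitiveB// /Rintegral fineK//.
by apply: integrable_fin_num => //; exact: ig.
Qed.

Lemma primitive_nondecreasing g a b : locally_summable g ->
  (forall x, 0 <= g x) -> a <= b -> primitive g a <= primitive g b.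
Proof.
by move=> ig g0 ab; rewrite -subr_ge0 primitiveB// Rintegral_ge0.
Qed.

Lemma le_primitiveB g h k a b : locally_summable g -> locally_summable h ->
  a <= b -> (forall x, a <= x <= b -> g x <= k * h x) ->
  primitive g b - primitive g a <= k * (primitive h b - primitive h a).
Proof.
move=> ig ih ab gh; rewrite !primitiveB// -RintegralZl//.
apply: le_Rintegral => //.
by have := @integrableZl _ _ _ mu `[a, b]%classic (measurable_itv _) k _ (ih a b).
Qed.

(** The increments over disjoint intervals are bounded by the integral of |g|
    over the union, a set whose measure is the sum of the lengths; that integral
    is small with the measure. *)
Lemma abs_continuous_primitive g a b : locally_summable g ->
  abs_continuous_on a b (primitive g).
Proof.
move=> ig e e0.
have : mu.-integrable setT (EFin \o g \_ `[a, b]).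
  by rewrite -restrict_EFin; apply/integrable_restrict => //=; rewrite setTI.
move=> /integral_normr_continuous /(_ _ e0)[d [d0 /=]] small.
exists d => // n u v uv disj sumd.
pose E i := `]u i, v i]%classic.
have mE i : measurable (E i) by exact: measurable_itv.
have trivE : trivIset setT E.
  apply/trivIsetP => i j _ _ ij; rewrite -subset0 => x [].
  rewrite /E /= !in_itv/= => /andP[u1 v1] /andP[u2 v2].
  by case: (disj _ _ ij) => h; lra.
have muE i : mu (E i) = (v i - u i)%:E.
  rewrite lebesgue_measure_itv/= lte_fin; have [_ + _] := uv i.
  by rewrite le_eqVlt => /predU1P[->|->]; rewrite ?ltxx ?subrr.
pose U := \big[setU/set0]_(i < n) E i.
have mU : measurable U by exact: bigsetU_measurable.
have muU : mu U = (\sum_(i < n) (v i - u i))%:E.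
  rewrite -sumEFin measure_bigsetU_ord//.
  by apply: eq_bigr => i _; exact: muE.
have := small U mU; rewrite muU lte_fin => /(_ sumd).
apply: le_lt_trans.
set h := g \_ `[a, b].
have ih : mu.-integrable setT (EFin \o h).
  by rewrite -restrict_EFin; apply/integrable_restrict => //=; rewrite setTI.
have ihn A : measurable A -> mu.-integrable A (fun x => `|h x|%:E).
  move=> mA; apply: (@integrableS _ _ _ mu setT) => //.
  exact: (integrable_norm ih).
have -> : \int[mu]_(x in U) `|h x| = \sum_(i < n) \int[mu]_(x in E i) `|h x|.
  rewrite /Rintegral ge0_integral_bigsetU//=.
  - rewrite sum_fine//= => i _.
    by apply: integrable_fin_num; [exact: mE|exact: ihn (mE i)].
  - exact: index_enum_uniq.
  - exact: sub_trivIset trivE.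
  - by have /integrableP[] := ihn _ mU.
apply: ler_sum => i _; have [au uvi vb] := uv i.
rewrite primitiveB// -Rintegral_itv_obnd_cbnd//; last first.
  by apply: integrableS (ig (u i) (v i)) => //; exact: subset_itv_oc_cc.
have Eab : E i `<=` `[a, b].
  by move=> x; rewrite /E /= !in_itv/= => /andP[? ?]; apply/andP; split; lra.
apply: le_trans (le_normr_Rintegral _ _) _ => //.
  by apply: integrableS (ig a b).
rewrite le_eqVlt; apply/orP; left; apply/eqP; apply: eq_Rintegral => x.
by rewrite inE => /Eab xab; rewrite /h patchE mem_set.
Qed.
End primitive.

Lemma abs_continuous_continuous {R : realType} (y : R -> R) :
  (forall a b, a <= b -> abs_continuous_on a b y) -> continuous y.
Proof.
move=> ACy x; apply/cvgrPdist_lt => e e0.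
have [|h h0 small] := ACy (x - 1) (x + 1) _ e e0; first lra.
have ball u v : x - 1 <= u -> u <= v -> v <= x + 1 -> v - u < h ->
    `|y v - y u| < e.
  move=> u1 uv v1 vu.
  have := small 1 (fun=> u) (fun=> v); rewrite !big_ord1; apply => //.
  by move=> i j; rewrite !ord1 eqxx.
near=> t.
have : `|x - t| < Num.min h 1.
  near: t; apply: cvgr_dist_lt; first exact: cvg_id.
  by rewrite lt_min h0 ltr01.
rewrite lt_min ltr_norml ltr_norml => /andP[/andP[? ?] /andP[? ?]].
have [tx|xt] := leP t x; first by apply: ball; lra.
by rewrite distrC; apply: ball; lra.
Unshelve. all: by end_near. Qed.

(** The supremum of the sublevel set [F < m] works: by continuity F can be
    neither above nor below m there. *)
Lemma least_level {R : realType} (F : R -> R) (a b m : R) : continuous F ->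
  {homo F : x y / x <= y} -> F a < m -> m <= F b ->
  exists2 x, F x = m & forall y, y < x -> F y < m.
Proof.
move=> cF mF am mb.
pose S := [set y | F y < m].
have ubS c : m <= F c -> ubound S c.
  by move=> mc y; rewrite /S /= => ym; rewrite leNgt; apply/negP => /ltW/mF; lra.
have supS : has_sup S by split; [exists a|exists b; exact: ubS].
have below y : y < sup S -> F y < m.
  rewrite -subr_gt0 => /sup_adherent -/(_ _ supS)[z Sz].
  by rewrite opprB addrC subrK => /ltW/mF; move: Sz; rewrite /S /=; lra.
exists (sup S) => //; apply/eqP; rewrite eq_le; apply/andP; split.
  rewrite leNgt; apply/negP => ltm.
  have : \forall t \near (sup S)^'-, m < F t.
    apply: (cvgr_gt (F (sup S))) => //.
    exact: cvg_at_left_filter (cF _).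
  move=> near_gt.
  have : \forall t \near (sup S)^'-, False.
    near=> t.
    have : F t < m by apply: below; near: t; exact: nbhs_left_lt.
    have : m < F t by near: t.
    lra.
  by case/filter_ex.
rewrite leNgt; apply/negP => ltm.
have : \forall t \near (sup S)^'+, F t < m.
  apply: (cvgr_lt (F (sup S))) => //.
  exact: cvg_at_right_filter (cF _).
move=> near_lt.
have : \forall t \near (sup S)^'+, False.
  near=> t.
  have : t <= sup S by apply: sup_ubound (supS.2) _ _; rewrite /S /=; near: t.
  have : sup S < t by near: t; exact: nbhs_right_gt.
  lra.
by case/filter_ex.
Unshelve. all: by end_near. Qed.

Section primitive_calculus.
Context {R : realType}.
Local Notation mu := (@lebesgue_measure R).
Implicit Types (g : R -> R) (a b c x : R).

Lemma continuous_primitive g : locally_summable g -> continuous (primitive g).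
Proof.
by move=> ig; apply: abs_continuous_continuous => a b _; exact: abs_continuous_primitive.
Qed.

(** Near x the primitive differs by a constant from the integral based at the
    point x - 1, to which the one-sided fundamental theorem applies. *)
Lemma primitive_is_derive g x : locally_summable g ->
  lebesgue_pt g x -> is_derive x 1 (primitive g) (g x).
Proof.
move=> ig gx.
pose F y := \int[mu]_(t in [set` Interval (BLeft (x - 1)) (BRight y)]) g t.
have x1 : x < x + 1 by lra.
have ax : x - 1 < x by lra.
have [dF F'] := FTC1_lebesgue_pt x1 (ig (x - 1) (x + 1)) ax gx.
apply: (@near_eq_is_derive _ _ _ (cst (primitive g (x - 1)) + F)).
  near=> y; rewrite /F/= fctE/= -primitiveB//; first by lra.
  by near: y; apply: (cvgr_ge x); [exact: cvg_id|lra].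
rewrite -(add0r (g x)); apply: is_deriveD.
by apply: DeriveDef => //; rewrite -derive1E.
Unshelve. all: by end_near. Qed.

Lemma continuous_locally_summable g : continuous g -> locally_summable g.
Proof.
move=> cg a b; apply: continuous_compact_integrable; first exact: segment_compact.
exact: continuous_subspaceT.
Qed.

Lemma continuous_primitive_is_derive g x : continuous g ->
  is_derive x 1 (primitive g) (g x).
Proof.
move=> cg; apply: primitive_is_derive; first exact: continuous_locally_summable.
apply: (@continuous_lebesgue_pt _ _ _ setT) => //.
- by split => //; exact: openT.
- exact: continuous_measurable_fun.
- exact: cg.
Qed.

Lemma primitive_ae_derive g : locally_integrable setT g -> locally_summable g ->
  {ae mu, forall x, is_derive x 1 (primitive g) (g x)}.
Proof.
move=> lg ig; have := lebesgue_differentiation lg.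
apply: filterS; first exact: (ae_filter_ringOfSetsType mu).
by move=> x; exact: primitive_is_derive.
Qed.

Lemma locally_integrable_summable g :
  locally_integrable setT g -> locally_summable g.
Proof.
move=> [mg _ bg] a b; apply/integrableP; split.
  by apply/measurable_EFinP; exact: measurable_funS mg.
by have := bg `[a, b]%classic (@subsetT _ _) (@segment_compact _ a b).
Qed.

Lemma locally_integrableM g h : locally_integrable setT g -> continuous h ->
  locally_integrable setT (fun x => g x * h x).
Proof.
move=> [mg oT bg] ch; split => //.
  by apply: measurable_funM => //; exact: continuous_measurable_fun.
move=> K KT cK.
have [M [_ hM]] := compact_bounded (continuous_compact (continuous_subspaceT ch) cK).
have mK := compact_measurable cK.
have M0 : 0 <= Num.max M 0 + 1 by rewrite addr_ge0// le_max lexx orbT.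
apply: (@le_lt_trans _ _ (\int[mu]_(x in K) ((Num.max M 0 + 1)%:E * `|(g x)%:E|))%E).
  apply: ge0_le_integral => //=.
  - apply/measurable_EFinP; apply: measurableT_comp => //.
    apply: measurable_funM; first exact: measurable_funS mg.
    apply: measurable_funTS; exact: continuous_measurable_fun.
  - apply/measurable_EFinP; apply: measurable_funM => //.
    by apply: measurableT_comp => //; exact: measurable_funS mg.
  - move=> x Kx; rewrite lee_fin normrM mulrC ler_wpM2r// hM//.
    by rewrite ltr_pwDr// le_max lexx.
rewrite ge0_integralZl//=.
- by rewrite lte_mul_pinfty//; exact: bg.
- apply/measurable_EFinP.
  by apply: measurableT_comp => //; exact: measurable_funS mg.
Qed.

(** Monotone convergence along intervals increasing to D; used for both
    half-lines. *)
Lemma primitive_exhaustion g (D : set R) (a b : R^nat) A :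
  locally_summable g -> (forall x, 0 <= g x) -> (forall n, a n <= b n) ->
  {homo (fun n => `[a n, b n]%classic) : m n / (m <= n)%N >-> m `<=` n} ->
  D = \bigcup_n `[a n, b n]%classic -> (\int[mu]_(t in D) (g t)%:E = +oo)%E ->
  exists n, A <= primitive g (b n) - primitive g (a n).
Proof.
move=> ig g0 ab nd -> int_oo.
have : (\int[mu]_(x in `[a n, b n]) (g x)%:E @[n --> \oo] --> +oo)%E.
  rewrite -int_oo; apply: ge0_nondecreasing_set_cvg_integral => //.
  - by move=> m n mn; rewrite subsetEset; exact: nd.
  - by move=> n; have /integrableP[] := ig (a n) (b n).
  - by move=> n x _; rewrite lee_fin.
move=> /cvgeyPge/(_ A)[n _ /(_ n (leqnn n))] /=.
by rewrite integral_primitiveB// lee_fin; exists n.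
Qed.

Lemma primitive_unbounded_above g M : locally_summable g ->
  (forall x, 0 <= g x) -> (\int[mu]_(t in `[0%R, +oo[) (g t)%:E = +oo)%E ->
  exists x, M <= primitive g x.
Proof.
move=> ig g0 int_oo.
have [||||n] := @primitive_exhaustion g `[0%R, +oo[%classic (fun=> 0) (fun n => 0 + n%:R)
  (M - primitive g 0) ig g0.
- by move=> n; rewrite add0r ler0n.
- move=> m n mn x /=; rewrite !in_itv/= !add0r => /andP[-> /le_trans]; apply.
  by rewrite ler_nat.
- exact: itv_bndy_bigcup_BRight.
- exact: int_oo.
- by move=> h; exists (0 + n%:R); lra.
Qed.

Lemma primitive_unbounded_below g M : locally_summable g ->
  (forall x, 0 <= g x) -> (\int[mu]_(t in `]-oo, 0%R]) (g t)%:E = +oo)%E ->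
  exists x, primitive g x < M.
Proof.
move=> ig g0 int_oo.
have [||||n] := @primitive_exhaustion g `]-oo, 0%R]%classic (fun n => 0 - n%:R) (fun=> 0)
  (primitive g 0 - M + 1) ig g0.
- by move=> n; rewrite sub0r oppr_le0 ler0n.
- move=> m n mn x /=; rewrite !in_itv/= !sub0r => /andP[+ ->].
  by rewrite andbT; apply: le_trans; rewrite lerN2 ler_nat.
- exact: itvNy_bnd_bigcup_BLeft.
- exact: int_oo.
- by move=> h; exists (0 - n%:R); lra.
Qed.
End primitive_calculus.

(** * First hitting points and the radius d *)

(** A primitive of a nonnegative function may be constant on intervals, so its
    value does not determine the point.  Taking the least point at each level
    leaves no shorter concentric interval of the same mass inside the interval
    between two hitting points, so that d at its midpoint is not too small. *)
Definition first_hit {R : realType} (F : R -> R) (m x : R) :=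
  F x = m /\ forall y, y < x -> F y < m.


Lemma gap_chain {R : realType} (delta A B L L' : R) : 0 < delta ->
  L / 2 <= B -> delta * B <= A -> A <= L' -> delta * L <= 2 * L'.
Proof.
move=> delta0 LB dB AL.
have : delta * (L / 2) <= delta * B by rewrite ler_pM2l.
by lra.
Qed.

Section radius.
Context {R : realType} (r q : R -> R).
Local Notation mu := (@lebesgue_measure R).
Local Notation g := (fun t => q t / r t).
Local Notation s := (primitive g).
Local Notation d := (dfun r q).
Hypothesis ig : locally_summable g.
Hypothesis g0 : forall x, 0 <= g x.

Let s_mono : {homo s : x y / x <= y}.
Proof. by move=> x y; exact: primitive_nondecreasing. Qed.

Lemma dfun_setE x : [set e : R | 0 < e /\
    (\int[mu]_(t in `[(x - e)%R, (x + e)%R]) (q t / r t)%:E = 2%:E)%E] =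
  [set e : R | 0 < e /\ s (x + e) - s (x - e) = 2].
Proof.
apply/seteqP; split=> e /= [e0].
  by rewrite integral_primitiveB//; [case|lra].
by move=> se; rewrite integral_primitiveB ?se//; lra.
Qed.

(** The mass of the concentric intervals grows continuously from 0, so it takes
    the value 2 at some radius at most L. *)
Lemma dfun_le x L : 0 < L -> 2 <= s (x + L) - s (x - L) -> d x <= L.
Proof.
move=> L0 sL; rewrite /dfun dfun_setE.
pose h e := s (x + e) - s (x - e).
have ch : continuous h.
  move=> e; apply: cvgB.
    apply: (@continuous_comp _ _ _ (fun e => x + e) s).
      by apply: cvgD; [exact: cvg_cst|exact: cvg_id].
    exact: continuous_primitive.
  apply: (@continuous_comp _ _ _ (fun e => x - e) s).
    by apply: cvgB; [exact: cvg_cst|exact: cvg_id].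
  exact: continuous_primitive.
have h0 : h 0 = 0 by rewrite /h addr0 subr0 subrr.
have [|c] := @IVT _ h 0 L 2 (ltW L0) (continuous_subspaceT ch).
  by rewrite h0 ge_min le_max ler0n sL/= orbT.
rewrite in_itv/= => /andP[c0 cL] hc.
apply: le_trans cL; apply: ge_inf; first by exists 0 => y /= [/ltW].
split=> //; rewrite lt_neqAle c0 andbT; apply/eqP => c_0.
by move: hc; rewrite -c_0 h0; lra.
Qed.

Lemma dfun_ge x L : 0 < L -> s (x + L) - s (x - L) = 2 ->
  (forall e, e < L -> s (x + e) - s (x - e) < 2) -> L <= d x.
Proof.
move=> L0 sL small; rewrite /dfun dfun_setE.
apply: lb_le_inf; first by exists L.
move=> e /= [e0 se]; rewrite leNgt; apply/negP => /small.
by rewrite se ltxx.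
Qed.

(** A shorter concentric interval ends before the first point at level m + 2 and
    begins after p, so its mass is less than 2. *)
Lemma dfun_midpoint m p p' : first_hit s m p -> first_hit s (m + 2) p' ->
  p < p' /\ (p' - p) / 2 <= d ((p + p') / 2).
Proof.
move=> [sp _] [sp' lt_p'].
have pp' : p < p'.
  by rewrite ltNge; apply/negP => /s_mono; rewrite sp sp'; lra.
split=> //; apply: dfun_ge; first lra.
  have -> : (p + p') / 2 + (p' - p) / 2 = p' by lra.
  have -> : (p + p') / 2 - (p' - p) / 2 = p by lra.
  by rewrite sp sp'; lra.
move=> e eL; have /lt_p' : (p + p') / 2 + e < p' by lra.
have /s_mono : p <= (p + p') / 2 - e by lra.
by rewrite sp; lra.
Qed.

Variable delta : R.
Hypothesis delta0 : 0 < delta.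
Hypothesis d_cond : forall x t, `|t - x| <= d x -> delta * d x <= d t.

(** At the common endpoint p' the radius d is at most the length L of either gap,
    because the ball of radius L around p' contains that gap, whose mass is 2.
    On the other hand p' lies within d of the midpoint of each gap, so d(p') is
    at least delta times half the length of each. *)
Lemma consecutive_gaps_comparable m p p' p'' : first_hit s m p ->
  first_hit s (m + 2) p' -> first_hit s (m + 2 + 2) p'' ->
  delta * (p'' - p') <= 2 * (p' - p) /\ delta * (p' - p) <= 2 * (p'' - p').
Proof.
move=> h h' h''.
have [pp' dl] := dfun_midpoint h h'; have [pp'' dr] := dfun_midpoint h' h''.
case: h h' h'' => sp _ [sp' _] [sp'' _].
split.
- apply: (gap_chain (A := d p') delta0 dr).
    apply: d_cond.
    have -> : p' - (p' + p'') / 2 = - ((p'' - p') / 2) by field.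
    by rewrite normrN ger0_norm// divr_ge0// subr_ge0 ltW.
  apply: dfun_le; first by rewrite subr_gt0.
  rewrite subKr.
  have /s_mono : p' <= p' + (p' - p) by rewrite lerDl subr_ge0 ltW.
  by rewrite sp sp'; lra.
- apply: (gap_chain (A := d p') delta0 dl).
    apply: d_cond.
    have -> : p' - (p + p') / 2 = (p' - p) / 2 by field.
    by rewrite ger0_norm// divr_ge0// subr_ge0 ltW.
  apply: dfun_le; first by rewrite subr_gt0.
  rewrite (addrC p') subrK.
  have /s_mono : p' - (p'' - p') <= p' by rewrite gerBl subr_ge0 ltW.
  by rewrite sp'' sp'; lra.
Qed.

Hypothesis int_left : (\int[mu]_(t in `]-oo, 0%R]) (g t)%:E = +oo)%E.
Hypothesis int_right : (\int[mu]_(t in `[0%R, +oo[) (g t)%:E = +oo)%E.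

Lemma exists_first_hit m : exists x, first_hit s m x.
Proof.
have [b mb] := primitive_unbounded_above m ig g0 int_right.
have [a am] := primitive_unbounded_below m ig g0 int_left.
have [x] := least_level (continuous_primitive ig) s_mono am mb.
by move=> sx lt_x; exists x.
Qed.

(** Both outer gaps are at most 2 / delta times the middle one. *)
Lemma three_gaps m : exists p : R * R * R * R, let: (p0, p1, p2, p3) := p in
  [/\ [/\ p0 < p1, p1 < p2 & p2 < p3],
      [/\ first_hit s m p0, s p1 = m + 2, s p2 = m + 4 & first_hit s (m + 6) p3] &
      p3 - p0 <= (1 + 4 / delta) * (p2 - p1)].
Proof.
have [p0 h0] := exists_first_hit m.
have [p1 h1] := exists_first_hit (m + 2).
have [p2 h2] := exists_first_hit (m + 2 + 2).
have [p3 h3] := exists_first_hit (m + 2 + 2 + 2).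
exists (p0, p1, p2, p3).
have [p01 _] := dfun_midpoint h0 h1; have [p12 _] := dfun_midpoint h1 h2.
have [p23 _] := dfun_midpoint h2 h3.
have [_ c01] := consecutive_gaps_comparable h0 h1 h2.
have [c23 _] := consecutive_gaps_comparable h1 h2 h3.
split=> //.
  split=> //; first exact: h1.1.
    by rewrite h2.1; lra.
  by have -> : m + 6 = m + 2 + 2 + 2 by lra.
have : 2 / delta * (p2 - p1) >= p1 - p0.
  by rewrite mulrAC ler_pdivlMr// mulrC.
have : 2 / delta * (p2 - p1) >= p3 - p2.
  by rewrite mulrAC ler_pdivlMr// mulrC.
lra.
Qed.
End radius.

(** * A continuously differentiable plateau *)

Section plateau.
Context {R : realType}.
Implicit Types (f : R -> R) (a b c d u x : R).

(** A Taylor estimate with quadratic error, valid for all increments, avoids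
    treating the two sides of a kink of the derivative separately. *)
Lemma is_derive_quadratic f x l :
  (forall h, `|f (x + h) - f x - h * l| <= h ^+ 2) -> is_derive x 1 f l.
Proof.
move=> fl.
have cvg_f : h^-1 *: (f (h *: 1 + x) - f x) @[h --> 0^'] --> l.
  apply/cvgrPdist_le => e e0; near=> h.
  have h0 : h != 0 by near: h; exact: nbhs_dnbhs_neq.
  have he : `|h| <= e.
    near: h; apply: dnbhs0_le => //.
  have -> : l - h^-1 *: (f (h *: 1 + x) - f x) =
      - (h^-1 * (f (x + h) - f x - h * l)).
    by rewrite /GRing.scale/= mulr1 (addrC h x); field.
  rewrite normrN normrM normfV ler_pdivrMl ?normr_gt0//.
  apply: le_trans (fl h) _.
  by rewrite -real_normK ?num_real// expr2 ler_wpM2l.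
apply: DeriveDef; first by apply/cvg_ex; exists l.
exact/cvg_lim.
Unshelve. all: by end_near. Qed.

Definition pos_square u : R := (Num.max 0 u) ^+ 2.

Lemma is_derive_pos_square u : is_derive u 1 pos_square (2 * Num.max 0 u).
Proof.
apply: is_derive_quadratic => h; rewrite /pos_square ler_norml.
by case: (leP 0 u) => u0; case: (leP 0 (u + h)) => uh0; apply/andP; split; nra.
Qed.

(** Composing two one-sided parabolas gives a C^1 function equal to 1 on the
    negative half-line and to 0 from 1 onwards. *)
Definition descent u : R := pos_square (1 - pos_square u).
Definition descent' u : R :=
  - 4 * Num.max 0 (1 - pos_square u) * Num.max 0 u.

Lemma is_derive_descent u : is_derive u 1 descent (descent' u).
Proof.
have h1 := is_derive_pos_square u.
have h2 : is_derive u 1 (fun v => 1 - pos_square v) (- (2 * Num.max 0 u)).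
  rewrite -(sub0r (2 * _)); exact: is_deriveB.
have := @is_derive1_comp _ pos_square (fun v => 1 - pos_square v) u _ _
  (is_derive_pos_square (1 - pos_square u)) h2.
by rewrite /descent' /descent; congr (is_derive _ _ _ _); ring.
Qed.

Let pos_square_le0 u : u <= 0 -> pos_square u = 0.
Proof. by move=> u0; rewrite /pos_square max_l// expr0n. Qed.

Lemma descent_le0 u : u <= 0 -> descent u = 1.
Proof.
move=> u0.
by rewrite /descent (pos_square_le0 u0) subr0 /pos_square max_r// expr1n.
Qed.

Lemma descent'_le0 u : u <= 0 -> descent' u = 0.
Proof. by move=> u0; rewrite /descent' (max_l u0) mulr0. Qed.

Let pos_square_ge1 u : 1 <= u -> 1 - pos_square u <= 0.
Proof.
by move=> u1; rewrite subr_le0 /pos_square max_r ?exprn_ege1// (le_trans _ u1).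
Qed.

Lemma descent_ge1 u : 1 <= u -> descent u = 0.
Proof.
by move=> u1; rewrite /descent (pos_square_le0 (pos_square_ge1 u1)).
Qed.

Lemma descent'_ge1 u : 1 <= u -> descent' u = 0.
Proof.
by move=> u1; rewrite /descent' (max_l (pos_square_ge1 u1)) mulr0 mul0r.
Qed.

Lemma descent_itv u : 0 <= descent u <= 1.
Proof.
rewrite /descent {1 2}/pos_square sqr_ge0/= exprn_ile1// ?le_max ?lexx//.
by rewrite ge_max ler01 lerBlDr lerDl sqr_ge0.
Qed.

Lemma normr_descent'_le u : `|descent' u| <= 4.
Proof.
have [u0|u0] := leP u 0; first by rewrite descent'_le0// normr0.
have [u1|u1] := leP 1 u; first by rewrite descent'_ge1// normr0.
rewrite /descent' !normrM normrN (@ger0_norm _ 4)//.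
rewrite !ger0_norm ?le_max ?lexx// -mulrA -[leRHS]mulr1 ler_wpM2l//.
rewrite mulr_ile1 ?le_max ?lexx// ge_max ler01/=; last exact: ltW.
by rewrite lerBlDr lerDl sqr_ge0.
Qed.

Lemma continuous_descent' : continuous descent'.
Proof.
have cmax f : continuous f -> continuous (fun u => Num.max 0 (f u)).
  by move=> cf u; apply: (@continuous_max _ _ (cst 0) f u); [exact: cvg_cst|exact: cf].
have cid : continuous (fun u : R => u) by move=> u; exact: cvg_id.
have csq : continuous (fun u => 1 - pos_square u).
  move=> u; apply: cvgB; first exact: cvg_cst.
  by rewrite /pos_square; under eq_fun do rewrite expr2;
     rewrite expr2; apply: cvgM; exact: (cmax _ cid u).
move=> u; apply: cvgM; last exact: (cmax _ cid u).
apply: cvgM; first exact: cvg_cst.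
exact: (cmax _ csq u).
Qed.

(** Equal to 1 on [b, c], to 0 outside [a, d], with transitions over [a, b] and
    [c, d]. *)
Definition plateau a b c d x : R :=
  descent ((b - x) / (b - a)) * descent ((x - c) / (d - c)).

Definition plateau' a b c d x : R :=
  descent ((b - x) / (b - a)) * (descent' ((x - c) / (d - c)) / (d - c)) -
  descent ((x - c) / (d - c)) * (descent' ((b - x) / (b - a)) / (b - a)).

Section plateau_theory.
Variables a b c d : R.
Hypotheses (ab : a < b) (cd : c < d).
Local Notation psi := (plateau a b c d).
Local Notation psi' := (plateau' a b c d).

Lemma is_derive_plateau x : is_derive x 1 psi (psi' x).
Proof.
have h1 : is_derive x 1 (fun v => (b - v) / (b - a)) (- (b - a)^-1).
  apply: is_derive_quadratic => h.
  rewrite (_ : _ - _ = 0) ?normr0 ?sqr_ge0//; field.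
  by rewrite subr_eq0 gt_eqF.
have h2 : is_derive x 1 (fun v => (v - c) / (d - c)) ((d - c)^-1).
  apply: is_derive_quadratic => h.
  rewrite (_ : _ - _ = 0) ?normr0 ?sqr_ge0//; field.
  by rewrite subr_eq0 gt_eqF.
have d1 := @is_derive1_comp _ descent (fun v => (b - v) / (b - a)) x _ _
  (is_derive_descent ((b - x) / (b - a))) h1.
have d2 := @is_derive1_comp _ descent (fun v => (v - c) / (d - c)) x _ _
  (is_derive_descent ((x - c) / (d - c))) h2.
have := is_deriveM d1 d2.
rewrite /plateau /plateau'/=; congr (is_derive _ _ _ _).
by rewrite /GRing.scale/=; ring.
Qed.

Lemma plateau_itv x : 0 <= psi x <= 1.
Proof.
have /andP[? ?] := descent_itv ((b - x) / (b - a)).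
have /andP[? ?] := descent_itv ((x - c) / (d - c)).
by rewrite mulr_ge0//= mulr_ile1.
Qed.

Lemma plateau_eq1 x : b <= x <= c -> psi x = 1.
Proof.
move=> /andP[bx xc]; rewrite /psi !descent_le0 ?mulr1//.
- by rewrite pmulr_lle0 ?subr_le0// invr_gt0 subr_gt0.
- by rewrite pmulr_lle0 ?subr_le0// invr_gt0 subr_gt0.
Qed.

Let right_out x : d <= x -> 1 <= (x - c) / (d - c).
Proof. by move=> dx; rewrite ler_pdivlMr ?subr_gt0// mul1r lerD2r. Qed.

Let left_out x : x <= a -> 1 <= (b - x) / (b - a).
Proof. by move=> xa; rewrite ler_pdivlMr ?subr_gt0// mul1r lerD2l lerN2. Qed.

Lemma plateau_eq0 x : x <= a \/ d <= x -> psi x = 0.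
Proof.
case=> [/left_out|/right_out] h.
- by rewrite /plateau (descent_ge1 h) mul0r.
- by rewrite /plateau (descent_ge1 h) mulr0.
Qed.

Lemma plateau'_eq0 x : x <= a \/ d <= x -> psi' x = 0.
Proof.
case=> [/left_out|/right_out] h.
- by rewrite /plateau' (descent_ge1 h) (descent'_ge1 h) !(mul0r, mulr0) subr0.
- by rewrite /plateau' (descent_ge1 h) (descent'_ge1 h) !(mul0r, mulr0) subr0.
Qed.

Lemma normr_plateau'_le x : `|psi' x| <= 4 / (b - a) + 4 / (d - c).
Proof.
have /andP[? ?] := descent_itv ((b - x) / (b - a)).
have /andP[? ?] := descent_itv ((x - c) / (d - c)).
have bound D u e : 0 <= D <= 1 -> 0 < e -> `|D * (descent' u / e)| <= 4 / e.
  move=> /andP[D0 D1] e0.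
  rewrite normrM (normrM (descent' u)) (ger0_norm D0) normfV (gtr0_norm e0).
  rewrite -[leRHS]mul1r ler_pM//.
    by rewrite mulr_ge0// invr_ge0 ltW.
  by rewrite ler_wpM2r ?invr_ge0 ?(ltW e0)// normr_descent'_le.
rewrite addrC; apply: le_trans (ler_normB _ _) _.
by rewrite lerD// bound ?descent_itv// subr_gt0.
Qed.

Lemma continuous_plateau' : continuous psi'.
Proof.
have cdesc : continuous descent.
  move=> u; apply/differentiable_continuous/derivable1_diffP.
  by have [] := is_derive_descent u.
have cb : continuous (fun x => (b - x) / (b - a)).
  move=> x; apply: cvgM; last exact: cvg_cst.
  by apply: cvgB; [exact: cvg_cst|exact: cvg_id].
have cc : continuous (fun x => (x - c) / (d - c)).
  move=> x; apply: cvgM; last exact: cvg_cst.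
  by apply: cvgB; [exact: cvg_id|exact: cvg_cst].
move=> x; apply: cvgB; apply: cvgM.
- exact: (continuous_comp (cb x) (cdesc _)).
- apply: cvgM; last exact: cvg_cst.
  exact: (@continuous_comp _ _ _ (fun x => (x - c) / (d - c)) descent' x (cc x)
    (@continuous_descent' _)).
- exact: (continuous_comp (cc x) (cdesc _)).
- apply: cvgM; last exact: cvg_cst.
  exact: (@continuous_comp _ _ _ (fun x => (b - x) / (b - a)) descent' x (cb x)
    (@continuous_descent' _)).
Qed.

Lemma plateau_lipschitz x y :
  `|psi y - psi x| <= (4 / (b - a) + 4 / (d - c)) * `|y - x|.
Proof.
wlog xy : x y / x <= y.
  move=> wl; have [|/ltW yx] := leP x y; first exact: wl.
  by rewrite distrC (distrC y); exact: wl.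
have cpsi : continuous psi.
  move=> u; apply/differentiable_continuous/derivable1_diffP.
  by have [] := is_derive_plateau u.
have [||t _ ->] := @MVT_segment _ psi psi' x y xy.
- by move=> u _; exact: is_derive_plateau.
- exact: continuous_subspaceT.
by rewrite normrM ler_wpM2r// normr_plateau'_le.
Qed.
End plateau_theory.
End plateau.

Lemma abs_continuous_dominated {R : realType} (a b C : R) (F A B : R -> R) :
  abs_continuous_on a b A -> abs_continuous_on a b B -> 0 < C ->
  (forall u v, a <= u -> u <= v -> v <= b ->
     `|F v - F u| <= C * (`|A v - A u| + `|B v - B u|)) ->
  abs_continuous_on a b F.
Proof.
move=> acA acB C0 FAB e e0.
have e2 : 0 < e / (2 * C) by rewrite divr_gt0// mulr_gt0.
have [h1 h10 small1] := acA _ e2; have [h2 h20 small2] := acB _ e2.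
exists (Num.min h1 h2); first by rewrite lt_min h10.
move=> n u v uv disj; rewrite lt_min => /andP[lt1 lt2].
have {small1} small1 := small1 n u v uv disj lt1.
have {small2} small2 := small2 n u v uv disj lt2.
apply: (@le_lt_trans _ _
    (C * (\sum_(i < n) `|A (v i) - A (u i)| + \sum_(i < n) `|B (v i) - B (u i)|))).
  by rewrite -big_split mulr_sumr ler_sum// => i _; have [] := uv i; exact: FAB.
have -> : e = C * (e / (2 * C) + e / (2 * C)).
  by field; rewrite gt_eqF.
by rewrite ltr_pM2l// ltrD.
Qed.

Lemma expR_sub_le {R : realType} (x y M : R) : x <= y -> y <= M ->
  `|expR y - expR x| <= expR M * `|y - x|.
Proof.
move=> xy yM; rewrite !ger0_norm ?subr_ge0 ?ler_expR//.
apply: (@le_trans _ _ (expR y * (y - x))); last first.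
  by rewrite ler_wpM2r ?subr_ge0// ler_expR.
have : expR y * (1 + (x - y)) <= expR y * expR (x - y).
  by rewrite ler_wpM2l ?expR_ge0// expR_ge1Dx.
rewrite -expRD (_ : y + (x - y) = x); last by ring.
lra.
Qed.

(** * The test pair *)

Section test_function.
Context {R : realType} (r q : R -> R).
Local Notation mu := (@lebesgue_measure R).
Hypotheses (r_cont : continuous r) (r_pos : forall x, 0 < r x).
Hypotheses (q_ge0 : forall x, 0 <= q x).
Hypothesis q_loc : locally_integrable setT q.

Local Notation s := (primitive (fun t => q t / r t)).
Local Notation rho := (primitive (fun t => (r t)^-1)).

Let continuous_invr : continuous (fun t => (r t)^-1).
Proof. by move=> x; apply: cvgV; [rewrite gt_eqF|exact: r_cont]. Qed.

Lemma quotient_locally_integrable :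
  locally_integrable setT (fun t => q t / r t).
Proof. exact: locally_integrableM. Qed.

Lemma quotient_locally_summable : locally_summable (fun t => q t / r t).
Proof. exact/locally_integrable_summable/quotient_locally_integrable. Qed.

Lemma inv_locally_summable : locally_summable (fun t => (r t)^-1).
Proof. exact: continuous_locally_summable. Qed.

Lemma rho_increasing x y : x < y -> rho x < rho y.
Proof.
move=> xy; rewrite -subr_gt0.
have [||t _ ->] := @MVT_segment _ rho (fun t => (r t)^-1) x y (ltW xy).
- by move=> t _; exact: continuous_primitive_is_derive.
- by apply/continuous_subspaceT/continuous_primitive/inv_locally_summable.
by rewrite mulr_gt0 ?subr_gt0// invr_gt0.
Qed.

Lemma mass_nondecreasing x y : x <= y -> s x <= s y.
Proof.
apply: primitive_nondecreasing; first exact: quotient_locally_summable.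
by move=> t; rewrite divr_ge0// ltW.
Qed.

(** Where q <= eps, the density q / r is at most eps times 1 / r. *)
Lemma rho_gap_ge eps a b : 0 < eps -> a <= b ->
  (forall x, a <= x <= b -> q x <= eps) -> s b - s a = 2 ->
  2 / eps <= rho b - rho a.
Proof.
move=> eps0 ab qe <-; rewrite ler_pdivrMr// mulrC.
apply: le_primitiveB => //.
- exact: quotient_locally_summable.
- exact: inv_locally_summable.
- by move=> x /qe qx; rewrite ler_wpM2r// invr_ge0 ltW.
Qed.

(** Hitting points tend to either end of the line with their level, so a level
    can be chosen for which the three gaps lie where q <= eps. *)
Lemma levels_below_eps eps :
  (q x @[x --> -oo] --> (0 : R) \/ q x @[x --> +oo] --> (0 : R)) -> 0 < eps ->
  exists m, forall p p', first_hit s m p -> first_hit s (m + 6) p' ->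
    forall x, p <= x <= p' -> q x <= eps.
Proof.
move=> q_lim eps0.
case: q_lim => /cvgr_lt/(_ _ eps0) [N [_ qN]].
- exists (s (N - 1) - 6) => p p' _ [_ hit] x /andP[_ xp'].
  apply/ltW/qN; apply: (@le_lt_trans _ _ (N - 1)); last lra.
  apply: le_trans xp' _; rewrite leNgt; apply/negP => /hit; lra.
- exists (s N + 1) => p p' [sp _] _ x /andP[px _].
  apply/ltW/qN; apply: lt_le_trans px.
  by rewrite ltNge; apply/negP => /mass_nondecreasing; rewrite sp; lra.
Qed.
Variables (m p0 p1 p2 p3 : R).
Hypotheses (p01 : p0 < p1) (p23 : p2 < p3).

Let psi := plateau (rho p0) (rho p1) (rho p2) (rho p3).
Let psi' := plateau' (rho p0) (rho p1) (rho p2) (rho p3).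

(** Variation of constants: e^s solves the homogeneous equation, and rho' = 1 / r
    cancels the coefficient r of y', so the datum depends on r and q
    only through the continuous functions s and rho. *)
Definition test_solution x := expR (s x - m) * psi (rho x).
Definition test_datum x := - (expR (s x - m) * psi' (rho x)).

Let rho_mono x y : x <= y -> rho x <= rho y.
Proof. by rewrite le_eqVlt => /predU1P[->//|/rho_increasing/ltW]. Qed.

Lemma test_solution_eq0 x : ~~ (p0 <= x <= p3) -> test_solution x = 0.
Proof.
move=> xo; rewrite /test_solution /psi plateau_eq0 ?mulr0//; try exact: rho_increasing.
move: xo; rewrite negb_and -!ltNge => /orP[] /ltW/rho_mono; by [left|right].
Qed.

Lemma test_datum_eq0 x : ~~ (p0 <= x <= p3) -> test_datum x = 0.
Proof.
move=> xo; rewrite /test_datum /psi' plateau'_eq0 ?mulr0 ?oppr0//;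
  try exact: rho_increasing.
move: xo; rewrite negb_and -!ltNge => /orP[] /ltW/rho_mono; by [left|right].
Qed.

Let continuous_exp : continuous (fun x => expR (s x - m)).
Proof.
move=> x; apply: (@continuous_comp _ _ _ (fun x => s x - m) expR).
  apply: cvgB; last exact: cvg_cst.
  exact/continuous_primitive/quotient_locally_summable.
exact: continuous_expR.
Qed.

Lemma continuous_test_datum : continuous test_datum.
Proof.
move=> x; apply: cvgN; apply: cvgM; first exact: continuous_exp.
apply: (@continuous_comp _ _ _ rho psi').
  exact/continuous_primitive/inv_locally_summable.
exact: continuous_plateau'.
Qed.

Lemma test_solution_ge1 x : m <= s p1 -> p1 <= x <= p2 ->
  1 <= `|test_solution x|.
Proof.
move=> ms /andP[p1x xp2].
rewrite /test_solution /psi plateau_eq1 ?rho_mono//; try exact: rho_increasing.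
rewrite mulr1 ger0_norm ?expR_ge0// -expR0 ler_expR subr_ge0.
exact: le_trans (mass_nondecreasing p1x).
Qed.

Lemma normr_test_datum_le k x : s p3 <= m + k ->
  `|test_datum x| <=
  expR k * (4 / (rho p1 - rho p0) + 4 / (rho p3 - rho p2)).
Proof.
move=> sk; have [T1 T3] := (rho_increasing p01, rho_increasing p23).
have [/andP[_ xp3]|xo] := boolP (p0 <= x <= p3); last first.
  by rewrite test_datum_eq0// normr0 mulr_ge0 ?expR_ge0// addr_ge0//
    divr_ge0// subr_ge0 ltW.
rewrite /test_datum normrN (normrM (expR _)) (ger0_norm (expR_ge0 _)).
rewrite ler_pM ?expR_ge0 ?ler_expR ?normr_plateau'_le//.
by rewrite lerBlDl (le_trans (mass_nondecreasing xp3)).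
Qed.

(** The increment of a product splits into increments of rho and of s: the
    plateau is Lipschitz, and so is the exponential on the bounded range of s
    over [a, b]. *)
Lemma abs_continuous_test_solution a b : abs_continuous_on a b test_solution.
Proof.
have [T1 T3] := (rho_increasing p01, rho_increasing p23).
pose L := 4 / (rho p1 - rho p0) + 4 / (rho p3 - rho p2).
have L0 : 0 <= L by rewrite addr_ge0// divr_ge0// subr_ge0 ltW.
pose E := expR (s b - m).
have E0 : 0 < E by exact: expR_gt0.
apply: (@abs_continuous_dominated _ a b (E * (L + 1)) _ s rho).
- exact/abs_continuous_primitive/quotient_locally_summable.
- exact/abs_continuous_primitive/inv_locally_summable.
- by rewrite mulr_gt0// ltr_wpDl.
move=> u v au uv vb.
have -> : test_solution v - test_solution u =
    expR (s v - m) * (psi (rho v) - psi (rho u)) +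
    psi (rho u) * (expR (s v - m) - expR (s u - m)).
  by rewrite /test_solution; ring.
apply: le_trans (ler_normD _ _) _.
rewrite (normrM (expR _)) (normrM (psi _)).
have /andP[psi0 psi1] := plateau_itv (rho p0) (rho p1) (rho p2) (rho p3) (rho u).
have : `|expR (s v - m)| * `|psi (rho v) - psi (rho u)| <= E * (L * `|rho v - rho u|).
  rewrite (ger0_norm (expR_ge0 _)) ler_pM ?expR_ge0//.
    by rewrite ler_expR lerD2r mass_nondecreasing.
  exact: plateau_lipschitz.
have : `|psi (rho u)| * `|expR (s v - m) - expR (s u - m)| <= 1 * (E * `|s v - s u|).
  rewrite (ger0_norm psi0) ler_pM//.
  have -> : s v - s u = (s v - m) - (s u - m) by ring.
  by apply: expR_sub_le; rewrite lerD2r mass_nondecreasing.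
have := mulr_ge0 (mulr_ge0 (ltW E0) L0) (normr_ge0 (s v - s u)).
have := mulr_ge0 (ltW E0) (normr_ge0 (rho v - rho u)).
lra.
Qed.

Lemma test_solution_solves : is_solution r q test_datum test_solution.
Proof.
split.
- by move=> a b _; exact: abs_continuous_test_solution.
- have := primitive_ae_derive quotient_locally_integrable quotient_locally_summable.
  apply: filterS; first exact: (ae_filter_ringOfSetsType mu).
  move=> x sx.
  have rx := continuous_primitive_is_derive x continuous_invr.
  have d1 : is_derive x 1 (fun x => s x - m) (q x / r x).
    rewrite -[X in is_derive _ _ _ X]subr0; exact: is_deriveB.
  have d2 := @is_derive1_comp _ expR (fun x => s x - m) x _ _ (is_derive_expR _) d1.
  have d3 := @is_derive1_comp _ psi rho x _ _
    (is_derive_plateau (rho_increasing p01) (rho_increasing p23) _) rx.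
  have [dy y'] : is_derive x 1 test_solution
      (expR (s x - m) * (psi' (rho x) / r x) +
       psi (rho x) * (expR (s x - m) * (q x / r x))) := is_deriveM d2 d3.
  split=> //; rewrite derive1E y' /test_datum /test_solution.
  by field; rewrite gt_eqF.
- apply: (@cvg_trans _ (cst 0 x @[x --> -oo])); last exact: cvg_cst.
  apply: near_eq_cvg; near=> x; rewrite /cst test_solution_eq0//.
  rewrite negb_and -!ltNge; apply/orP; left; near: x.
  by apply: nbhs_ninfty_lt; exact: num_real.
- apply: (@cvg_trans _ (cst 0 x @[x --> +oo])); last exact: cvg_cst.
  apply: near_eq_cvg; near=> x; rewrite /cst test_solution_eq0//.
  rewrite negb_and -!ltNge; apply/orP; right; near: x.
  by apply: nbhs_pinfty_gt; exact: num_real.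
Unshelve. all: by end_near. Qed.
End test_function.

(** * Norms of functions supported on a segment *)

Section Lp_norms.
Context {R : realType}.
Local Notation mu := (@lebesgue_measure R).
Implicit Types (f h : R -> R) (a b c d M K P : R).
Local Open Scope ereal_scope.

Definition vanishes_outside f a b := forall x, ~~ (a <= x <= b)%R -> f x = 0%R.

Let measurable_normr_powR f P : continuous f ->
  measurable_fun [set: R] (fun x => (`|f x| `^ P)%:E).
Proof.
move=> cf; apply/measurable_EFinP.
apply: (measurableT_comp (measurable_powR P)).
by apply: measurableT_comp => //; exact: continuous_measurable_fun.
Qed.

Lemma integral_powR_le f a b M P : (a <= b)%R -> (0 < P)%R -> continuous f ->
  vanishes_outside f a b -> (forall x, `|f x| <= M)%R ->
  \int[mu]_x (`|f x| `^ P)%:E <= (M `^ P * (b - a))%:E.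
Proof.
move=> ab P0 cf f_out fM.
have M0 : (0 <= M)%R by apply: le_trans (fM 0%R).
have -> : (M `^ P * (b - a))%:E = \int[mu]_(x in `[a, b]) (M `^ P)%:E.
  rewrite integral_cst//= lebesgue_measure_itv/= lte_fin.
  by case: ltgtP ab => // [-> _]; rewrite ?subrr ?mulr0 ?mule0.
rewrite [leRHS]integral_mkcond; apply: ge0_le_integral => //.
- exact: measurable_normr_powR.
- exact/(measurable_restrictT _ _).1.
- move=> x _; rewrite patchE; case: ifPn => xab.
    by rewrite lee_fin ge0_ler_powR// ?nnegrE// ltW.
  rewrite f_out ?normr0 ?powR0 ?gt_eqF//.
  by move: xab; rewrite notin_setE/= in_itv/= => /negP.
Qed.

Lemma integral_powR_ge h c d P : (c <= d)%R -> (0 < P)%R -> continuous h ->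
  (forall x, c <= x <= d -> 1 <= `|h x|)%R ->
  (d - c)%:E <= \int[mu]_x (`|h x| `^ P)%:E.
Proof.
move=> cd P0 ch h1.
have -> : (d - c)%:E = \int[mu]_(x in `[c, d]) 1%:E.
  rewrite integral_cst//= lebesgue_measure_itv/= lte_fin mul1e.
  by case: ltgtP cd => // [-> _]; rewrite ?subrr.
apply: (@le_trans _ _ (\int[mu]_(x in `[c, d]) (`|h x| `^ P)%:E)).
  apply: ge0_le_integral => //.
  - by apply: measurable_funTS; exact: measurable_normr_powR.
  - move=> x /=; rewrite in_itv/= => /h1 hx.
    by rewrite lee_fin -[leLHS](congr1 (fun f => f P) (@powR1 R)) ge0_ler_powR ?nnegrE// ltW.
apply: ge0_subset_integral => //; exact: measurable_normr_powR.
Qed.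

Lemma continuous_vanishing_bounded f a b : (a <= b)%R -> continuous f ->
  vanishes_outside f a b -> exists M, forall x, (`|f x| <= M)%R.
Proof.
move=> ab cf f_out.
have cn : continuous (fun x => `|f x|%R).
  by move=> x; apply: cvg_norm; exact: cf.
have [c _ cmax] := EVT_max ab (continuous_subspaceT cn).
exists `|f c|%R => x; have [xab|/f_out->] := boolP (a <= x <= b)%R.
  by apply: cmax; rewrite in_itv.
by rewrite normr0.
Qed.

Lemma in_Lp_vanishing f a b (p : \bar R) : (a <= b)%R -> 1 <= p -> continuous f ->
  vanishes_outside f a b -> in_Lp p f.
Proof.
move=> ab p1 cf f_out.
have [M fM] := continuous_vanishing_bounded ab cf f_out.
case: p p1 => [P| |] //=; last first.
  move=> _; split=> //; exists M; split; first exact: num_real.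
  by move=> N MN x _; apply: le_trans (fM x) (ltW MN).
rewrite lee_fin => P1; have P0 : (0 < P)%R by exact: lt_le_trans P1.
rewrite inE; apply/andP; split; rewrite inE/=.
  exact: continuous_measurable_fun.
rewrite /finite_norm unlock; apply: poweR_lty.
by apply: le_lt_trans (integral_powR_le ab P0 cf f_out fM) (ltry _).
Qed.

(** The integral of |f|^p is at most M^p (b - a) and that of |h|^p at least
    d - c, so the lengths enter only through K^(1/p) <= K; in the sup norm they
    do not enter at all. *)
Lemma Lp_norm_le f h a b c d M K (p : \bar R) : 1 <= p ->
  (a <= b)%R -> (c < d)%R -> (b - a <= K * (d - c))%R -> (1 <= K)%R ->
  continuous f -> vanishes_outside f a b -> (forall x, `|f x| <= M)%R ->
  continuous h -> vanishes_outside h a b ->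
  (forall x, c <= x <= d -> 1 <= `|h x|)%R ->
  [/\ 0 < Lp_norm p h, Lp_norm p h < +oo &
      Lp_norm p f <= (M * K)%:E * Lp_norm p h].
Proof.
move=> p1 ab cd baK K1 cf f_out fM ch h_out h1.
have M0 : (0 <= M)%R by apply: le_trans (fM 0%R).
have K0 : (0 <= K)%R by exact: le_trans K1.
have hp := in_Lp_vanishing ab p1 ch h_out.
case: p p1 hp => [P| |] //; last first.
  move=> _ _ /=; set N := ereal_sup _.
  have N1 : 1 <= N.
    apply: (@le_trans _ _ `|h c|%:E); first by rewrite lee_fin h1// lexx ltW.
    by apply: ereal_sup_ubound; exists c.
  have [L hL] := continuous_vanishing_bounded ab ch h_out.
  split; first exact: lt_le_trans N1.
    apply: (@le_lt_trans _ _ L%:E); last exact: ltry.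
    by apply: ge_ereal_sup => _ [x _ <-]; rewrite lee_fin.
  apply: ge_ereal_sup => _ [x _ <-].
  apply: (@le_trans _ _ ((M * K)%:E * 1)); last first.
    by rewrite lee_wpmul2l// lee_fin mulr_ge0.
  by rewrite mule1 lee_fin (le_trans (fM x))// ler_peMr.
rewrite lee_fin => P1 hp; have P0 : (0 < P)%R by exact: lt_le_trans P1.
have Pi0 : (0 < P^-1)%R by rewrite invr_gt0.
have lb := integral_powR_ge (ltW cd) P0 ch h1.
have ub := integral_powR_le ab P0 cf f_out fM.
split.
- rewrite /= unlock; apply: poweR_gt0; apply: lt_le_trans lb.
  by rewrite lte_fin subr_gt0.
- move: hp; rewrite /= inE => /andP[_].
  by rewrite inE.
- rewrite /= unlock.
  set I := \int[mu]_x _; set J := \int[mu]_x _.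
  have I0 : 0 <= I by apply: integral_ge0 => x _; rewrite lee_fin powR_ge0.
  have J0 : 0 <= J by apply: integral_ge0 => x _; rewrite lee_fin powR_ge0.
  have -> : (M * K)%:E = ((M * K) `^ P)%:E `^ P^-1.
    by rewrite poweR_EFin -powRrM mulfV ?gt_eqF// powRr1// mulr_ge0.
  rewrite -poweRM ?lee_fin ?powR_ge0//.
  apply: gt0_ler_poweR; rewrite ?(ltW Pi0)//.
  - by rewrite in_itv/= I0 leey.
  - by rewrite in_itv/= mule_ge0 ?leey// lee_fin powR_ge0.
  apply: (@le_trans _ _ (((M * K) `^ P)%:E * (d - c)%:E)).
    apply: le_trans ub _; rewrite -EFinM lee_fin powRM// -mulrA.
    rewrite ler_wpM2l ?powR_ge0// (le_trans baK)// ler_wpM2r ?subr_ge0 ?(ltW cd)//.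
    exact: le1r_powR.
  by rewrite lee_wpmul2l// lee_fin powR_ge0.
Qed.
End Lp_norms.

(** * Failure of the a priori bound *)

Theorem theorem9p1 (R : realType) (r q : R -> R)
  (r_cont : continuous r) (r_pos : forall x, 0 < r x)
  (q_ge0 : forall x, 0 <= q x) (q_loc : locally_integrable setT q)
  (int_left : (\int[leb R]_(t in `]-oo, 0%R]) (q t / r t)%:E = +oo)%E)
  (int_right : (\int[leb R]_(t in `[0%R, +oo[) (q t / r t)%:E = +oo)%E)
  (d_cond : exists2 delta : R, 0 < delta &
     forall x t : R, `|t - x| <= dfun r q x ->
       delta * dfun r q x <= dfun r q t)
  (q_lim : q x @[x --> -oo] --> (0 : R) \/ q x @[x --> +oo] --> (0 : R))
  (p : \bar R) (p_ge1 : (1 <= p)%E) :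
  ~ correctly_solvable r q p.
Proof.
move=> [_ [c c0 apriori]].
have [delta delta0 dc] := d_cond.
pose K := 1 + 4 / delta.
have K1 : 1 <= K by rewrite lerDl divr_ge0// ltW.
have K0 : 0 < K by exact: lt_le_trans K1.
have e6 : 0 < expR 6 :> R by exact: expR_gt0.
(* The a priori bound together with [Lp_norm_le] costs the factor
   c * (expR 6 * 4 * eps) * K, which this eps makes equal to 1 / 2. *)
pose eps := (8 * c * K * expR 6)^-1.
have eps0 : 0 < eps by rewrite invr_gt0 !mulr_gt0.
have ig := quotient_locally_summable r_cont r_pos q_loc.
have g0 x : 0 <= q x / r x by rewrite divr_ge0// ltW.
have [m small] := levels_below_eps r_cont r_pos q_ge0 q_loc q_lim eps0.
have [[[[p0 p1] p2] p3]] := three_gaps ig g0 delta0 dc int_left int_right m.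
move=> [[p01 p12 p23] [h0 s1 s2 h3] p03].
have {}small := small _ _ h0 h3.
case: h0 h3 => s0 _ [s3 _].
have T1 := @rho_gap_ge _ _ _ r_cont r_pos q_loc eps p0 p1 eps0 (ltW p01).
have {}T1 := T1 ltac:(by move=> x /andP[? ?]; apply: small; apply/andP; split; lra)
  ltac:(lra).
have T3 := @rho_gap_ge _ _ _ r_cont r_pos q_loc eps p2 p3 eps0 (ltW p23).
have {}T3 := T3 ltac:(by move=> x /andP[? ?]; apply: small; apply/andP; split; lra)
  ltac:(lra).
set f := test_datum r q m p0 p1 p2 p3.
set y := test_solution r q m p0 p1 p2 p3.
have sol : is_solution r q f y by exact: test_solution_solves.
have f_out : vanishes_outside f p0 p3 by exact: test_datum_eq0.
have y_out : vanishes_outside y p0 p3 by exact: test_solution_eq0.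
have cf : continuous f by exact: continuous_test_datum.
have cy : continuous y.
  by apply: abs_continuous_continuous => a b ab; case: sol => + _ _ _; exact.
have p03' : p0 <= p3 by lra.
have y1 x : p1 <= x <= p2 -> 1 <= `|y x|.
  by apply: test_solution_ge1 => //; rewrite s1 lerDl.
have fM x : `|f x| <= expR 6 * (4 * eps).
  have small_inv T : 2 / eps <= T -> 4 / T <= 2 * eps.
    move=> eT; have T0 : 0 < T by apply: lt_le_trans eT; rewrite divr_gt0.
    by move: eT; rewrite !ler_pdivrMr//; clear; lra.
  apply: le_trans (@normr_test_datum_le _ _ _ r_cont r_pos q_ge0 q_loc _ _ _ _ _
    p01 p23 6 x _) _; first by rewrite s3.
  rewrite ler_wpM2l ?expR_ge0//.
  have := lerD (small_inv _ T1) (small_inv _ T3).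
  by rewrite -mulrDl; congr (_ <= _ * _); ring.
have [y_gt0 y_fin fy] := Lp_norm_le p_ge1 p03' p12 p03 K1 cf f_out fM cy y_out y1.
have := apriori f y (in_Lp_vanishing p03' p_ge1 cf f_out) sol
  (in_Lp_vanishing p03' p_ge1 cy y_out).
apply/negP; rewrite -ltNge.
move: y_gt0 y_fin fy; case: (Lp_norm p y) => [Y| |]// Y0 _ fy.
apply: (@le_lt_trans _ _ (c%:E * ((expR 6 * (4 * eps) * K)%:E * Y%:E))%E).
  by rewrite lee_wpmul2l// lee_fin ltW.
rewrite -!EFinM lte_fin.
have -> : c * (expR 6 * (4 * eps) * K * Y) = Y / 2.
  by rewrite /eps; field; rewrite !gt_eqF.
by move: Y0; rewrite lte_fin; lra.
Qed.
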